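(* Let $N\ge 1$, let $\mathcal R=(m,b,\ell,\{P_s,g_s,q_s\}_{s=0}^{N-1})$ be a length-$N$ one-gradient realization with memory $m$, let $X$ be a finite-dimensional real Hilbert space, let $H$ be a self-adjoint operator on $X$ with spectrum in $[\mu,L]$, let $B_0,\dots,B_{N-1}\in\operatorname{End}(X)$, and let $H_s=H+\delta B_s$ for $\delta\in\mathbb R$, $0\le s\le N-1$. Then the derivative at $\delta=0$ of the output map $x_0\mapsto x_N$ of $\mathcal R$ run with the time-varying Hessians $H_0,\dots,H_{N-1}$ has the form $$D\mathcal T_{\mathcal R,H}[B_0,\ldots,B_{N-1}]=\sum_{s=0}^{N-1}\mathcal L_{s,H}(B_s),$$ where each $\mathcal L_{s,H}:\operatorname{End}(X)\to\operatorname{End}(X)$ is linear and, for every pair of eigenvalues $\lambda,\nu$ of $H$, $$\mathcal L_{s,H}(B_s)_{\lambda\nu}=K_{s,\mathcal R}(\lambda,\nu)\,(B_s)_{\lambda\nu}.$$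
   Context: Fix $0<\mu<L$. A length-$N$ one-gradient realization with memory $m$ is a tuple $\mathcal R=(m,b,\ell,\{P_s,g_s,q_s\}_{s=0}^{N-1})$ with $b,\ell,g_s,q_s\in\mathbb R^m$ and $P_s\in\mathbb R^{m\times m}$. It acts on $Y_s\in\mathbb R^m\otimes X$ by $$Y_{s+1}=(P_s\otimes I_X)Y_s-(g_s\otimes I_X)\nabla f((q_s^\top\otimes I_X)Y_s),\quad Y_0=b\otimes x_0,\quad x_N=(\ell^\top\otimes I_X)Y_N.$$ With time-varying Hessians $H_0,\dots,H_{N-1}\in\operatorname{End}(X)$, the gradient at step $s$ is replaced by $v\mapsto H_s v$, so that the output map is the linear operator on $X$ $$\mathcal T_{\mathcal R}=(\ell^\top\otimes I_X)\,\mathsf C_{N-1}(H_{N-1})\cdots\mathsf C_0(H_0)\,(b\otimes I_X),\qquad \mathsf C_s(A)=P_s\otimes I_X-g_sq_s^\top\otimes A.$$ $D\mathcal T_{\mathcal R,H}[B_0,\dots,B_{N-1}]$ denotes $\frac{d}{d\delta}\big|_{\delta=0}$ of this operator for $H_s=H+\delta B_s$. For scalars put $C_s(\lambda)=P_s-\lambda g_sq_s^\top$. The scalar first-variation kernel is $$K_{s,\mathcal R}(\lambda,\nu)=-\ell^\top C_{N-1}(\lambda)\cdots C_{s+1}(\lambda)\,g_sq_s^\top\,C_{s-1}(\nu)\cdots C_0(\nu)\,b,$$ with empty products equal to the identity. For an operator $A$ on $X$ and eigenvalues $\lambda,\nu$ of $H$, $(A)_{\lambda\nu}:=\Pi_\lambda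 A\,\Pi_\nu$, where $\Pi_\lambda$ is the orthogonal projector onto the $\lambda$-eigenspace of $H$. *)

(* Defs.v *)
From HB Require Import structures.
From mathcomp Require Import all_boot all_order all_algebra.
From mathcomp Require Import sesquilinear.
From mathcomp Require Import all_classical all_reals all_analysis.

Set Implicit Arguments.
Unset Strict Implicit.
Unset Printing Implicit Defensive.

Import Order.TTheory GRing.Theory Num.Theory.
Import passmx.
Import numFieldNormedType.Exports.

Local Open Scope classical_set_scope.
Local Open Scope ring_scope.

(* [m] is the memory; steps are indexed by ['I_N]. *)
Record realization (R : realType) (N : nat) := Realization {
  mem : nat;
  rz_b : 'cV[R]_mem;
  rz_l : 'cV[R]_mem;
  rz_P : 'I_N -> 'M[R]_mem;
  rz_g : 'I_N -> 'cV[R]_mem;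
  rz_q : 'I_N -> 'cV[R]_mem }.

(* R^m (x) X is identified with X^m = {ffun 'I_m -> X} through
   e_i (x) x |-> (0, .., x, .., 0) with x at index i. *)
Section Tensor.
Variables (R : realType) (X : vectType R) (m : nat).

Definition tens_fun (M : 'M[R]_m) (A : 'End(X)) (Y : {ffun 'I_m -> X}) :
  {ffun 'I_m -> X} := [ffun i => \sum_j M i j *: A (Y j)].

Fact tens_fun_linear M A : linear (tens_fun M A).
Proof.
move=> a Y Z; apply/ffunP => i; rewrite !ffunE scaler_sumr -big_split /=.
apply: eq_bigr => j _.
by rewrite !ffunE linearP scalerDr !scalerA mulrC.
Qed.

HB.instance Definition _ M A :=
  GRing.isLinear.Build R _ _ _ (tens_fun M A) (tens_fun_linear M A).

(* M (x) A *)
Definition tens (M : 'M[R]_m) (A : 'End(X)) : 'End({ffun 'I_m -> X}) :=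
  linfun (tens_fun M A).

Definition tens_col_fun (v : 'cV[R]_m) (x : X) : {ffun 'I_m -> X} :=
  [ffun i => v i 0 *: x].

Fact tens_col_fun_linear v : linear (tens_col_fun v).
Proof.
move=> a x y; apply/ffunP => i; rewrite !ffunE scalerDr !scalerA.
by rewrite mulrC.
Qed.

HB.instance Definition _ v :=
  GRing.isLinear.Build R _ _ _ (tens_col_fun v) (tens_col_fun_linear v).

(* v (x) I_X : X -> X^m *)
Definition tens_col (v : 'cV[R]_m) : 'Hom(X, {ffun 'I_m -> X}) :=
  linfun (tens_col_fun v).

Definition tens_row_fun (v : 'cV[R]_m) (Y : {ffun 'I_m -> X}) : X :=
  \sum_i v i 0 *: Y i.

Fact tens_row_fun_linear v : linear (tens_row_fun v).
Proof.
move=> a Y Z; rewrite /tens_row_fun scaler_sumr -big_split /=.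
apply: eq_bigr => i _.
by rewrite !ffunE scalerDr !scalerA mulrC.
Qed.

HB.instance Definition _ v :=
  GRing.isLinear.Build R _ _ _ (tens_row_fun v) (tens_row_fun_linear v).

(* v^T (x) I_X : X^m -> X *)
Definition tens_row (v : 'cV[R]_m) : 'Hom({ffun 'I_m -> X}, X) :=
  linfun (tens_row_fun v).

End Tensor.

Section Realization.
Variables (R : realType) (N : nat) (rz : realization R N) (X : vectType R).

Definition step (grad : 'I_N -> X -> X) (Y : {ffun 'I_(mem rz) -> X})
    (s : 'I_N) : {ffun 'I_(mem rz) -> X} :=
  tens (rz_P rz s) \1%VF Y
  - tens_col X (rz_g rz s) (grad s (tens_row X (rz_q rz s) Y)).

(* x_0 |-> x_N, where step s uses the gradient oracle [grad s]. *)
Definition output (grad : 'I_N -> X -> X) (x0 : X) : X :=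
  tens_row X (rz_l rz)
    (foldl (step grad) (tens_col X (rz_b rz) x0) (enum 'I_N)).

Definition opC (s : 'I_N) (A : 'End(X)) : 'End({ffun 'I_(mem rz) -> X}) :=
  tens (rz_P rz s) \1%VF - tens (rz_g rz s *m (rz_q rz s)^T) A.

(* The operator T_R for the Hessians [Hs]; indices decrease from left to
   right in the product. *)
Definition transfer (Hs : 'I_N -> 'End(X)) : 'End(X) :=
  (tens_row X (rz_l rz)
   \o (\big[(@comp_lfun _ _ _ _)/(\1)]_(s <- rev (enum 'I_N)) opC s (Hs s))
   \o tens_col X (rz_b rz))%VF.

Lemma stepE (Hs : 'I_N -> 'End(X)) s Y :
  step (fun t => Hs t) Y s = opC s (Hs s) Y.
Proof.
rewrite /step /opC add_lfunE opp_lfunE; congr (_ - _).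
apply/ffunP => i; rewrite !lfunE /= !ffunE linear_sum scaler_sumr.
apply: eq_bigr => j _; rewrite mxE big_ord1 !mxE linearZ /=.
by rewrite scalerA.
Qed.

Lemma outputE (Hs : 'I_N -> 'End(X)) x0 :
  output (fun s => Hs s) x0 = transfer Hs x0.
Proof.
rewrite /output /transfer !comp_lfunE; congr (tens_row _ _ _).
elim/last_ind: (enum 'I_N) => [|t s IH]; first by rewrite big_nil id_lfunE.
by rewrite foldl_rcons IH stepE rev_rcons big_cons comp_lfunE.
Qed.

Definition matC (s : 'I_N) (lam : R) : 'M[R]_(mem rz) :=
  rz_P rz s - lam *: (rz_g rz s *m (rz_q rz s)^T).

Definition kernel1 (s : 'I_N) (lam nu : R) : R :=
  - ((rz_l rz)^T
     *m (\big[mulmx/1%:M]_(t <- rev (enum 'I_N) | (s < t)%N) matC t lam)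
     *m (rz_g rz s *m (rz_q rz s)^T)
     *m (\big[mulmx/1%:M]_(t <- rev (enum 'I_N) | (t < s)%N) matC t nu)
     *m rz_b rz) 0 0.

End Realization.

(* A finite-dimensional real Hilbert space is a [vectType] over the reals
   with a positive definite symmetric form [dot]. *)
Section Hilbert.
Variables (R : realType) (X : vectType R) (dot : {dot X for idfun}).

Definition hnorm (x : X) : R := Num.sqrt (dot x x).

Definition self_adjoint (A : 'End(X)) : Prop :=
  forall x y, dot (A x) y = dot x (A y).

(* The orthogonal projector onto the eigenspace of [H] for [lam]. *)
Definition eigproj (H : 'End(X)) (lam : R) : 'End(X) :=
  daddv_pi (leigenspace H lam) (orthov dot (leigenspace H lam)).

Definition block (H : 'End(X)) (lam nu : R) (A : 'End(X)) : 'End(X) :=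
  (eigproj H lam \o A \o eigproj H nu)%VF.

(* D is the derivative at t of the operator-valued F in operator norm:
   || (F (t + d) - F t) / d - D || <= e for all small d != 0, with the bound
   on the operator norm spelled out on vectors. *)
Definition is_op_deriv (F : R -> 'End(X)) (t : R) (D : 'End(X)) : Prop :=
  forall e : R, 0 < e -> \forall d \near (0 : R)^',
    forall x : X,
      hnorm ((d^-1 *: (F (t + d) - F t) - D) x) <= e * hnorm x.

End Hilbert.

(* Main.v *)
(* With U_s = C_s(H), the product of the C_s(H + d B_s) is a polynomial in d with
   operator coefficients; its degree-one coefficient is the sum over s of the
   products with U_s replaced by - g_s q_s^T (x) B_s, and the higher ones are
   negligible because every operator on X is bounded.  In the block (lam, nu), the
   projector onto the lam-eigenspace on the left turns each C_t(H), t > s, into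
   the scalar matrix C_t(lam) -- this is where self-adjointness enters -- and the
   projector on the right turns each C_t(H), t < s, into C_t(nu), so that only a
   scalar multiple of the block of B_s is left. *)
From HB Require Import structures.
Require Import Defs.
From mathcomp Require Import all_boot all_order all_algebra.
From mathcomp Require Import sesquilinear.
From mathcomp Require Import all_classical all_reals all_analysis.
From mathcomp Require Import ring lra.

Set Implicit Arguments.
Unset Strict Implicit.
Unset Printing Implicit Defensive.

Import Order.TTheory GRing.Theory Num.Theory.
Import passmx numFieldNormedType.Exports.
Local Open Scope ring_scope.

(** * Norm, orthogonal complements and eigenprojectors of a positive definite form *)

Section DotProduct.
Variables (R : realType) (X : vectType R) (dot : {dot X for idfun}).
Local Notation nrm := (hnorm dot).

Lemma dotC x y : dot x y = dot y x.
Proof. by rewrite hermC expr0 mul1r. Qed.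

Lemma dotZl a x y : dot (a *: x) y = a * dot x y.
Proof. exact: (linearZl_LR dot). Qed.

Lemma dotZr a x y : dot x (a *: y) = a * dot x y.
Proof. by rewrite dotC dotZl dotC. Qed.

Lemma dot_ge0 x : 0 <= dot x x.
Proof.
by have [->|/(neq0_dnorm_gt0 (s := dot))/ltW //] := eqVneq x 0; rewrite linear0l.
Qed.

Lemma dot_eq0 x : dot x x = 0 -> x = 0.
Proof.
move=> x0; apply/eqP; apply: contraT => /(neq0_dnorm_gt0 (s := dot)).
by rewrite x0 ltxx.
Qed.

Lemma hnorm_ge0 x : 0 <= nrm x.
Proof. exact: sqrtr_ge0. Qed.

Lemma sqr_hnorm x : nrm x ^+ 2 = dot x x.
Proof. by rewrite sqr_sqrtr ?dot_ge0. Qed.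

Lemma dot_CauchySchwarz x y : dot x y ^+ 2 <= dot x x * dot y y.
Proof.
have [->|y0] := eqVneq y 0; first by rewrite !raddf0 expr0n mulr0.
have yy := neq0_dnorm_gt0 (s := dot) _ y0.
rewrite -subr_ge0 -(pmulr_rge0 _ yy).
(* This vector is [dot y y] times the component of [x] orthogonal to [y]; its square is [dot y y]
   times the difference of the two sides. *)
have := dot_ge0 (dot y y *: x - dot x y *: y).
rewrite !(linearBl, linearBr) /= !(dotZl, dotZr) (dotC y x).
by move/le_trans; apply; rewrite le_eqVlt; apply/orP; left; apply/eqP; ring.
Qed.

Lemma normr_dot_le x y : `|dot x y| <= nrm x * nrm y.
Proof.
rewrite -sqrtr_sqr -sqrtrM ?dot_ge0 // ler_sqrt ?dot_CauchySchwarz //.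
by rewrite mulr_ge0 ?dot_ge0.
Qed.

Lemma hnormD_le x y : nrm (x + y) <= nrm x + nrm y.
Proof.
rewrite -(@ler_pXn2r _ 2) ?nnegrE ?addr_ge0 ?hnorm_ge0 // sqrrD !sqr_hnorm.
rewrite linearDl !linearDr /= (dotC y x).
have := le_trans (ler_norm _) (normr_dot_le x y); lra.
Qed.

Lemma hnormZ a x : nrm (a *: x) = `|a| * nrm x.
Proof.
by rewrite /hnorm dotZl dotZr mulrA -expr2 sqrtrM ?sqr_ge0 // sqrtr_sqr.
Qed.

Lemma hnorm0 : nrm 0 = 0.
Proof. by rewrite /hnorm raddf0 sqrtr0. Qed.

Lemma hnorm_sum_le I (r : seq I) (F : I -> X) :
  nrm (\sum_(i <- r) F i) <= \sum_(i <- r) nrm (F i).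
Proof.
elim/big_rec2: _ => [|i a y _ IH]; first by rewrite hnorm0.
by apply: le_trans (hnormD_le _ _) _; rewrite lerD2l.
Qed.

(** Turns orthogonality to the span of [b] into membership in the kernel of a linear map, so that
    rank-nullity applies. *)
Definition dot_row_fun d (b : d.-tuple X) (x : X) : 'rV[R]_d :=
  \row_i dot x b`_i.

Fact dot_row_fun_linear d (b : d.-tuple X) : linear (dot_row_fun b).
Proof.
by move=> a x y; apply/rowP => i; rewrite !mxE linearDl /= dotZl.
Qed.

HB.instance Definition _ d (b : d.-tuple X) :=
  GRing.isLinear.Build R _ _ _ (dot_row_fun b) (dot_row_fun_linear b).

Definition dot_row d (b : d.-tuple X) : 'Hom(X, 'rV[R]_d) :=
  linfun (dot_row_fun b).

Lemma lker_dot_row (U : {vspace X}) : lker (dot_row (vbasis U)) = orthov dot U.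
Proof.
apply/vspaceP => x; rewrite memv_ker lfunE /=.
apply/eqP/mem_orthovP => [x0 v|x0].
  move=> /coord_vbasis ->; rewrite raddf_sum big1 // => i _.
  rewrite /= dotZr.
  by have /rowP/(_ i) := x0; rewrite !mxE => ->; rewrite mulr0.
apply/rowP => i; rewrite !mxE; apply: x0.
by apply: vbasis_mem; rewrite mem_nth ?size_tuple.
Qed.

Lemma orthov_fullv : orthov dot fullv = 0%VS.
Proof.
apply/eqP; rewrite -subv0; apply/subvP => x /mem_orthovP/(_ x (memvf x)).
by move=> /dot_eq0 ->; rewrite mem0v.
Qed.

Lemma capv_orthov (U : {vspace X}) : (U :&: orthov dot U)%VS = 0%VS.
Proof.
apply/eqP; rewrite -subv0; apply/subvP => x; rewrite memv_cap => /andP[xU].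
by move=> /mem_orthovP/(_ x xU)/dot_eq0 ->; rewrite mem0v.
Qed.

(** Dimension count: the complement is the kernel of a map into rows of length [\dim U], so its
    dimension is at least [\dim {:X} - \dim U], and it meets [U] only in zero. *)
Lemma addv_orthov (U : {vspace X}) : (U + orthov dot U)%VS = fullv.
Proof.
apply/eqP; rewrite eqEdim subvf dimv_disjoint_sum ?capv_orthov //=.
rewrite -lker_dot_row -(limg_ker_dim (dot_row (vbasis U)) fullv) capfv addnC.
rewrite leq_add2r; apply: leq_trans (dimvS (subvf _)) _.
by rewrite dimvf dim_matrix mul1r.
Qed.

(* Coordinates are dot products against a fixed basis up to the invertible Gram
   map, so Cauchy-Schwarz bounds every operator. *)
Lemma end_bounded (A : 'End(X)) :
  exists2 C, 0 <= C & forall x, nrm (A x) <= C * nrm x.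
Proof.
pose f := dot_row (vbasis fullv).
have fK : cancel f f^-1%VF.
  by apply: lker0_lfunK; rewrite lker_dot_row orthov_fullv.
(* The vectors [f^-1 (delta_mx 0 i)] form the dual basis for [dot]: the coefficients of [x] in it
   are its dot products with the fixed basis. *)
pose c i := A (f^-1%VF (delta_mx 0 i)).
exists (\sum_i nrm (c i) * nrm ((vbasis fullv)`_i)).
  by apply: sumr_ge0 => i _; rewrite mulr_ge0 ?hnorm_ge0.
move=> x; have -> : A x = \sum_(i < \dim {:X}) dot x (vbasis fullv)`_i *: c i.
  rewrite -{1}(fK x) (row_sum_delta (f x)) !raddf_sum /=.
  apply: eq_bigr => i _; rewrite !linearZ /=; congr (_ *: _).
  by rewrite lfunE mxE.
apply: le_trans (hnorm_sum_le _ _) _.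
rewrite mulr_suml; apply: ler_sum => i _; rewrite hnormZ mulrC -mulrA.
by rewrite ler_wpM2l ?hnorm_ge0 // mulrC normr_dot_le.
Qed.

Section Eigenprojector.
Variables (H : 'End(X)) (lam : R).

Lemma eigproj_eigen x : H (eigproj dot H lam x) = lam *: eigproj dot H lam x.
Proof.
have := memv_pi (leigenspace H lam) (orthov dot (leigenspace H lam)) x.
by rewrite memv_ker !lfun_simp subr_eq0 => /eqP.
Qed.

Lemma eigproj_sub x : x - eigproj dot H lam x \in orthov dot (leigenspace H lam).
Proof.
rewrite -{1}(daddv_pi_add (capv_orthov (leigenspace H lam)) (w := x)).
  by rewrite addrC addKr memv_pi.
by rewrite addv_orthov memvf.
Qed.

Lemma eigproj_orthov x :
  x \in orthov dot (leigenspace H lam) -> eigproj dot H lam x = 0.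
Proof.
move=> xO; apply/eqP; rewrite -memv0 -(capv_orthov (leigenspace H lam)).
(* The projection of [x] is [x - (x - p)], a difference of two vectors of the complement, and it
   also lies in the eigenspace. *)
rewrite memv_cap memv_pi -[X in X \in orthov _ _](subKr x).
by rewrite rpredB ?eigproj_sub.
Qed.

Hypothesis H_sa : self_adjoint dot H.

(** A self-adjoint [H] maps the orthogonal complement of an eigenspace into itself, so [H (x - p)]
    is killed by the projector. *)
Lemma eigproj_comm x : eigproj dot H lam (H x) = lam *: eigproj dot H lam x.
Proof.
set p := eigproj dot H lam x.
have -> : H x = H (x - p) + lam *: p by rewrite -eigproj_eigen -linearD subrK.
rewrite linearD linearZ /= [X in _ *: X]daddv_pi_proj ?capv_orthov //.
rewrite eigproj_orthov ?add0r //.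
have /mem_orthovP xO := eigproj_sub x.
apply/mem_orthovP => v vE /=; rewrite H_sa.
move: (vE); rewrite memv_ker !lfun_simp subr_eq0 => /eqP ->.
by rewrite dotZr xO ?mulr0.
Qed.

End Eigenprojector.

End DotProduct.

(** * Expansion of an ordered operator product in powers of [d] *)

Section ProductExpansion.
Variables (R : realType) (U : vectType R) (N : nat).
Implicit Types (A V : 'I_N -> 'End(U)) (r : seq 'I_N).

Local Notation "\comp_ ( i <- r | P ) F" :=
  (\big[(@comp_lfun _ _ _ _)/(\1)%VF]_(i <- r | P) F)
  (at level 41, i at level 50, format "\comp_ ( i  <-  r  |  P )  F").
Local Notation "\comp_ ( i <- r ) F" :=
  (\big[(@comp_lfun _ _ _ _)/(\1)%VF]_(i <- r) F)
  (at level 41, i at level 50, format "\comp_ ( i  <-  r )  F").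

(** Comparing indices splits the product at [s] correctly when [r] is strictly decreasing; this
    matches the index filters of [kernel1]. *)
Definition prod_variation A V r : 'End(U) :=
  \sum_(s <- r) ((\comp_(t <- r | (s < t)%N) A t) \o V s
                 \o (\comp_(t <- r | (t < s)%N) A t))%VF.

(** Leibniz rule: either the leading factor is varied or one of the tail; the bound on [r] makes the
    filters agree with list positions. *)
Lemma prod_variation_cons A V (t : 'I_N) r : all (fun s : 'I_N => (s < t)%N) r ->
  prod_variation A V (t :: r) =
  (V t \o (\comp_(s <- r) A s))%VF + (A t \o prod_variation A V r)%VF.
Proof.
move=> /allP lt_t; rewrite /prod_variation big_cons; congr (_ + _).
  rewrite !big_cons !ltnn big_seq_cond big_pred0 ?comp_lfun1l; last first.
    move=> s; apply/negbTE/negP => /andP[/lt_t st ts].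
    by have := ltn_trans st ts; rewrite ltnn.
  congr (_ \o _)%VF; rewrite [RHS]big_seq [LHS]big_seq_cond.
  by apply: eq_bigl => s; case: (boolP (s \in r)) => // /lt_t ->.
apply/lfunP => x; rewrite comp_lfunE !sum_lfunE linear_sum !big_seq.
apply: eq_bigr => s /lt_t st.
by rewrite !big_cons st ltnNge (ltnW st) /= !comp_lfunE.
Qed.

(** The list [w] does not depend on [d], and an entry [(k, T)] stands for [d ^+ k.+2 *: T], so
    divisibility of the remainder by [d ^+ 2] is built in. *)
Lemma prod_expansion A V r : sorted (fun s t : 'I_N => (t < s)%N) r ->
  exists w : seq (nat * 'End(U)), forall d : R,
    \comp_(t <- r) (A t + d *: V t) =
    \comp_(t <- r) A t + d *: prod_variation A V r
    + \sum_(p <- w) d ^+ p.1.+2 *: p.2.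
Proof.
elim: r => [_|t r IH rtr].
  by exists [::] => d; rewrite /prod_variation !big_nil scaler0 !addr0.
have lt_t : all (fun s : 'I_N => (s < t)%N) r.
  apply: (order_path_min (leT := fun s t : 'I_N => (t < s)%N)) rtr.
  by move=> a b c ba ac; exact: ltn_trans ac ba.
have [w wE] := IH (path_sorted rtr).
(* The new remainder collects the product of the two first-order terms, the old remainder times
   [A t], and the old remainder times [d *: V t], one degree higher. *)
exists ((0%N, V t \o prod_variation A V r)%VF ::
  [seq (p.1, (A t \o p.2)%VF) | p <- w]
  ++ [seq (p.1.+1, (V t \o p.2)%VF) | p <- w]) => d.
rewrite prod_variation_cons // !big_cons wE big_cat !big_map /=.
move: (prod_variation A V r) (\comp_(s <- r) A s) => D P; 
have comp_sum B : (B \o \sum_(p <- w) d ^+ p.1.+2 *: p.2)%VF =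
    \sum_(p <- w) d ^+ p.1.+2 *: (B \o p.2)%VF.
  apply/lfunP => x; rewrite comp_lfunE !sum_lfunE linear_sum.
  by apply: eq_bigr => p _; rewrite !scale_lfunE linearZ comp_lfunE.
have -> : \sum_(p <- w) d ^+ p.1.+3 *: (V t \o p.2)%VF =
    d *: (V t \o \sum_(p <- w) d ^+ p.1.+2 *: p.2)%VF.
  by rewrite comp_sum scaler_sumr; apply: eq_bigr => p _; rewrite scalerA -exprS.
rewrite -comp_sum; move: (\sum_(p <- w) _) => W.
apply/lfunP => x.
rewrite !(comp_lfunE, add_lfunE, scale_lfunE, linearD, linearZ) /= scalerA -expr2.
move: (A t (P x)) (A t (D x)) (A t (W x)) (V t (P x)) (V t (D x)) (V t (W x)).
(* The six products are regrouped as degree zero, degree one and remainder. *)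
by move=> *; rewrite [LHS](AC (3*3) (1*(4*2)*(5*(3*6)))).
Qed.

End ProductExpansion.

(** * Calculus of matrices and vectors tensored with operators *)

Section TensorTheory.
Variables (R : realType) (X : vectType R) (m : nat).

Lemma tensE (M : 'M[R]_m) (A : 'End(X)) Y i :
  tens M A Y i = \sum_j M i j *: A (Y j).
Proof. by rewrite lfunE /= ffunE. Qed.

Lemma tens_colE (v : 'cV[R]_m) (x : X) i : tens_col X v x i = v i 0 *: x.
Proof. by rewrite lfunE /= ffunE. Qed.

Lemma tens_rowE (v : 'cV[R]_m) (Y : {ffun 'I_m -> X}) :
  tens_row X v Y = \sum_i v i 0 *: Y i.
Proof. by rewrite lfunE. Qed.

Lemma tensDr (M : 'M[R]_m) (A B : 'End(X)) : tens M (A + B) = tens M A + tens M B.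
Proof.
apply/lfunP => Y; apply/ffunP => i; rewrite add_lfunE ffunE !tensE -big_split.
by apply: eq_bigr => j _; rewrite add_lfunE scalerDr.
Qed.

Lemma tensZr (M : 'M[R]_m) a (A : 'End(X)) : tens M (a *: A) = a *: tens M A.
Proof.
apply/lfunP => Y; apply/ffunP => i; rewrite scale_lfunE ffunE !tensE scaler_sumr.
by apply: eq_bigr => j _; rewrite scale_lfunE !scalerA mulrC.
Qed.

(** Absorbs a factor into the covector from the output end, moving [A] outside, where a projector
    can meet it; [tens_tens_col] is the mirror image at the input end. *)
Lemma tens_row_tens (v : 'cV[R]_m) (M : 'M[R]_m) (A : 'End(X)) Y :
  tens_row X v (tens M A Y) = A (tens_row X (M^T *m v) Y).
Proof.
rewrite !tens_rowE linear_sum /=.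
under eq_bigr do rewrite tensE scaler_sumr.
rewrite exchange_big /=; apply: eq_bigr => j _.
rewrite mxE linearZ /= scaler_suml; apply: eq_bigr => i _.
by rewrite mxE scalerA mulrC.
Qed.

Lemma tens_tens_col (M : 'M[R]_m) (A : 'End(X)) (w : 'cV[R]_m) x :
  tens M A (tens_col X w x) = tens_col X (M *m w) (A x).
Proof.
apply/ffunP => i; rewrite tensE tens_colE mxE scaler_suml.
by apply: eq_bigr => j _; rewrite tens_colE linearZ /= scalerA.
Qed.

Lemma tens_row_col (v w : 'cV[R]_m) x :
  tens_row X v (tens_col X w x) = (v^T *m w) 0 0 *: x.
Proof.
rewrite tens_rowE mxE scaler_suml; apply: eq_bigr => i _.
by rewrite tens_colE scalerA mxE.
Qed.

Lemma tens_colZ a (v : 'cV[R]_m) x :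
  tens_col X v (a *: x) = tens_col X (a *: v) x.
Proof. by apply/ffunP => i; rewrite !tens_colE mxE scalerA mulrC. Qed.

Lemma tens_colBl (v w : 'cV[R]_m) x :
  tens_col X (v - w) x = tens_col X v x - tens_col X w x.
Proof. by apply/ffunP => i; rewrite !ffunE !tens_colE !mxE scalerBl. Qed.

Lemma tens_rowZl a (v : 'cV[R]_m) Y : tens_row X (a *: v) Y = a *: tens_row X v Y.
Proof.
rewrite !tens_rowE scaler_sumr; apply: eq_bigr => i _.
by rewrite mxE scalerA.
Qed.

Lemma tens_rowBl (v w : 'cV[R]_m) Y :
  tens_row X (v - w) Y = tens_row X v Y - tens_row X w Y.
Proof.
rewrite !tens_rowE -sumrB; apply: eq_bigr => i _.
by rewrite !mxE scalerBl.
Qed.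

End TensorTheory.

(** * First variation of the transfer operator and its spectral blocks *)

Section FirstVariation.
Variables (R : realType) (N : nat) (rz : realization R N) (X : vectType R).
Variables (dot : {dot X for idfun}) (H : 'End(X)).

Local Notation G s := (rz_g rz s *m (rz_q rz s)^T).
Local Notation opP r P :=
  (\big[(@comp_lfun _ _ _ _)/(\1)%VF]_(t <- r | P t) opC rz t H).
Local Notation matP r P lam :=
  (\big[mulmx/1%:M]_(t <- r | P t) matC rz t lam).

Lemma opC_perturb s (A B : 'End(X)) (d : R) :
  opC rz s (A + d *: B) = opC rz s A + d *: - tens (G s) B.
Proof. by rewrite /opC tensDr tensZr opprD addrA scalerN. Qed.

Lemma eigproj_opC_prod (H_sa : self_adjoint dot H) lam r (P : pred 'I_N) v Y :
  eigproj dot H lam (tens_row X v (opP r P Y)) =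
  eigproj dot H lam (tens_row X ((matP r P lam)^T *m v) Y).
Proof.
(* The covector [v] stays general because each absorbed factor changes it. *)
elim: r v => [|t r IH] v; first by rewrite !big_nil trmx1 mul1mx id_lfunE.
rewrite !big_cons; case: (P t) => //.
rewrite comp_lfunE trmx_mul -mulmxA -IH; move: (opP r P Y) => Z.
rewrite /opC add_lfunE opp_lfunE !linearB /= !tens_row_tens id_lfunE.
rewrite eigproj_comm // [(lam *: _)^T]linearZ /= mulmxBl -scalemxAl.
by rewrite tens_rowBl tens_rowZl [RHS]linearB [in RHS]linearZ.
Qed.

(** Each [H] acts directly on the projected vector, where it is multiplication by [nu]; the scalar
    matrices then act on [w] alone. *)
Lemma opC_prod_eigproj nu r (P : pred 'I_N) w x :
  opP r P (tens_col X w (eigproj dot H nu x)) =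
  tens_col X (matP r P nu *m w) (eigproj dot H nu x).
Proof.
elim: r => [|t r IH]; first by rewrite !big_nil mul1mx id_lfunE.
rewrite !big_cons; case: (P t) => //.
rewrite comp_lfunE IH -mulmxA; move: (matP r P nu *m w) => z.
rewrite /opC add_lfunE opp_lfunE !tens_tens_col id_lfunE eigproj_eigen.
by rewrite tens_colZ -tens_colBl /matC mulmxBl -scalemxAl.
Qed.

Definition step_variation (s : 'I_N) (B : 'End(X)) : 'End(X) :=
  (tens_row X (rz_l rz)
   \o (opP (rev (enum 'I_N)) (fun t : 'I_N => (s < t)%N) \o - tens (G s) B
       \o opP (rev (enum 'I_N)) (fun t : 'I_N => (t < s)%N))
   \o tens_col X (rz_b rz))%VF.

Fact step_variation_linear s : linear (step_variation s).
Proof.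
move=> a A B; rewrite /step_variation tensDr tensZr opprD -scalerN.
apply/lfunP => x.
by rewrite !(comp_lfunE, add_lfunE, scale_lfunE, linearD, linearZ) /=.
Qed.

HB.instance Definition _ s :=
  GRing.isLinear.Build R _ _ _ (step_variation s) (step_variation_linear s).

Lemma block_step_variation (H_sa : self_adjoint dot H) s lam nu B :
  block dot H lam nu (step_variation s B)
  = kernel1 rz s lam nu *: block dot H lam nu B.
Proof.
apply/lfunP => x; rewrite scale_lfunE !comp_lfunE opC_prod_eigproj.
(* With both outer products absorbed into vectors, contracting [tens (G s) B] leaves a scalar times
   [B]; the minus sign is the one in [kernel1]. *)
rewrite eigproj_opC_prod // opp_lfunE tens_tens_col linearN /= tens_row_col.
rewrite linearN linearZ -scaleNr /=; congr (_ *: _).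
by rewrite /kernel1 trmx_mul trmxK !mulmxA.
Qed.

Lemma transfer_expansion (B : 'I_N -> 'End(X)) :
  exists w : seq (nat * 'End(X)), forall d : R,
    transfer rz (fun s => H + d *: B s) =
    transfer rz (fun=> H) + d *: (\sum_(s < N) step_variation s (B s))
    + \sum_(p <- w) d ^+ p.1.+2 *: p.2.
Proof.
(* Later steps stand further left in the transfer product, which is the decreasing order that
   [prod_expansion] asks for. *)
have rE : sorted (fun s t : 'I_N => (t < s)%N) (rev (enum 'I_N)).
  have := iota_ltn_sorted 0 N.
  by rewrite rev_sorted -val_enum_ord sorted_map.
have [w wE] :=
  prod_expansion (fun s => opC rz s H) (fun s => - tens (G s) (B s)) rE.
exists [seq (p.1, (tens_row X (rz_l rz) \o p.2 \o tens_col X (rz_b rz))%VF)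
       | p <- w].
move=> d; rewrite /transfer.
under eq_bigr do rewrite opC_perturb.
rewrite wE big_map; apply/lfunP => x.
rewrite !(comp_lfunE, add_lfunE, scale_lfunE, linearD, linearZ) /=.
congr (_ + _ *: _ + _).
  have -> : \sum_(s < N) step_variation s (B s) =
      \sum_(s <- rev (enum 'I_N)) step_variation s (B s).
    by rewrite -big_enum; apply: perm_big; rewrite perm_sym perm_rev.
  rewrite /prod_variation !sum_lfunE linear_sum; apply: eq_bigr => s _.
  by rewrite !comp_lfunE.
rewrite !sum_lfunE linear_sum; apply: eq_bigr => p _.
by rewrite !(comp_lfunE, scale_lfunE, linearZ).
Qed.

End FirstVariation.

(** * From a polynomial expansion to the derivative in operator norm *)

Section OperatorDerivative.
Variables (R : realType) (X : vectType R) (dot : {dot X for idfun}).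

Lemma poly_remainder_bounded (w : seq (nat * 'End(X))) :
  exists2 C, 0 <= C & forall d x, `|d| <= 1 ->
    hnorm dot ((\sum_(p <- w) d ^+ p.1.+1 *: p.2) x) <= `|d| * (C * hnorm dot x).
Proof.
elim: w => [|[k A] w [C C0 Cw]].
  by exists 0 => // d x _; rewrite big_nil zero_lfunE hnorm0 mul0r mulr0.
have [CA CA0 CAx] := end_bounded dot A.
exists (CA + C); first exact: addr_ge0.
move=> d x d1; rewrite big_cons add_lfunE mulrDl mulrDr.
apply: le_trans (hnormD_le _ _ _) (lerD _ (Cw _ _ d1)).
(* One factor [|d|] is kept; the remaining power is at most 1. *)
rewrite scale_lfunE hnormZ normrX exprS -mulrA ler_wpM2l //.
apply: le_trans (CAx x); rewrite ler_piMl ?hnorm_ge0 //.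
by rewrite exprn_ile1.
Qed.

Lemma is_op_deriv_expansion (F : R -> 'End(X)) (D : 'End(X)) w :
  (forall d, F d = F 0 + d *: D + \sum_(p <- w) d ^+ p.1.+2 *: p.2) ->
  is_op_deriv dot F 0 D.
Proof.
move=> FE e e0; have [C C0 Cw] := poly_remainder_bounded w.
near=> d => x.
have d0 : d != 0 by near: d; exact: nbhs_dnbhs_neq.
have -> : d^-1 *: (F (0 + d) - F 0) - D = \sum_(p <- w) d ^+ p.1.+1 *: p.2.
  rewrite add0r (FE d) -(addrA (F 0)) [X in _ *: X]addrC addKr.
  rewrite scalerDr scalerA mulVf // scale1r addrC addKr scaler_sumr.
  apply: eq_bigr => p _.
  by rewrite scalerA [d ^+ p.1.+2]exprS mulKf.
apply: le_trans (Cw _ _ _) _; first by near: d; exact: dnbhs0_le.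
rewrite mulrA ler_wpM2r ?hnorm_ge0 //.
(* Dividing by [C + 1] instead of [C] covers the case [C = 0]. *)
have Cd : `|d| <= e / (C + 1).
  by near: d; apply: dnbhs0_le; rewrite divr_gt0 // ltr_wpDl.
have C1 : 0 < C + 1 by rewrite ltr_wpDl.
rewrite ler_pdivlMr // in Cd; apply: le_trans Cd.
by rewrite ler_wpM2l // lerDl.
Unshelve. all: by end_near.
Qed.

End OperatorDerivative.

Theorem lemma1p1 (R : realType) (mu L : R) (mu_gt0 : 0 < mu) (mu_ltL : mu < L)
    (N : nat) (N_ge1 : (1 <= N)%N) (rz : realization R N)
    (X : vectType R) (dot : {dot X for idfun})
    (H : 'End(X)) (H_sa : self_adjoint dot H)
    (H_spec : forall lam : R, leigenvalue H lam -> mu <= lam <= L) :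
  exists Ls : 'I_N -> {linear 'End(X) -> 'End(X)},
    forall B : 'I_N -> 'End(X),
      is_op_deriv dot
        (fun delta : R => transfer rz (fun s => H + delta *: B s)) 0
        (\sum_(s < N) Ls s (B s))
      /\ forall (s : 'I_N) (lam nu : R),
           leigenvalue H lam -> leigenvalue H nu ->
           block dot H lam nu (Ls s (B s))
           = kernel1 rz s lam nu *: block dot H lam nu (B s).
Proof.
exists (step_variation rz H) => B; split; last first.
  by move=> s lam nu _ _; exact: block_step_variation.
have [w wE] := transfer_expansion rz H B.
apply: (@is_op_deriv_expansion _ _ _ _ _ w) => d.
(* The expansion at [0] identifies the value there with the constant term, all remainder exponents
   being at least 2. *)
rewrite wE (wE 0) scale0r addr0 [X in _ = _ + X + _ + _]big1 ?addr0 // => p _.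
by rewrite expr0n scale0r.
Qed.
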